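(* Let $n\geq k\geq 6$ be integers and let $G$ be an edge-colored graph on $n$ vertices such that $m(G)+c(G)=\binom{n}{2}+t_{n,k-2}+1$ and $G$ does not contain a rainbow $K_k$. Then $G\in\mathcal{H}_k$.
   Context: Graphs are finite, simple and undirected. An edge-colored graph is a graph together with an arbitrary (not necessarily proper) assignment of a color to each edge. $m(G)$ denotes the number of edges of $G$, and $c(G)$ the number of distinct colors that actually appear on the edges of $G$. A subgraph is rainbow if all its edges have pairwise distinct colors. For $q\le n$, the Turán graph $T_{n,q}$ is the complete $q$-partite graph on $n$ vertices whose partite sets have sizes as equal as possible (each of size $\lfloor n/q\rfloor$ or $\lceil n/q\rceil$), and $t_{n,q}$ denotes its number of edges. $H_{n,q}$ denotes the edge-colored complete graph on $n$ vertices with a spanning subgraph $T_{n,q}$ whose edges all receive pairwise different colors, and in which all remaining edges (those inside the partite sets of $T_{n,q}$) are colored alike with one further color not used on $T_{n,q}$. Isomorphism of edge-colored graphs is understood up to renaming of colors. $\mathcal{H}_k$ is the set of all edge-colored graphs $H$ such that, with $n$ the number of vertices of $H$, either (I) $H$ is isomorphic to $H_{n,k-2}$, or (II) $\lfloor n/(k-2)\rfloor=1$, $H$ is complete, $c(H)=t_{n,k-2}+1$, and $H$ contains a rainbow $T_{n,k-2}$ as a subgraph but no rainbow $K_k$. *)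

(* Defs.v *)
(* MathComp *)
From mathcomp Require Import all_boot.

Set Implicit Arguments.
Unset Strict Implicit.
Unset Printing Implicit Defensive.

Record sgraph (V : finType) := SGraph {
  edges : {set {set V}};
  edges_card2 : {in edges, forall e : {set V}, #|e| = 2}
}.

(* Only the values of [color] on edges are meaningful: every notion below
   evaluates it on edges only. *)
Record ecgraph (C : eqType) (V : finType) := ECGraph {
  graph_of :> sgraph V;
  color : {set V} -> C
}.

Section Graphs.
Variable V : finType.

Fact complete_card2 :
  {in [set e : {set V} | #|e| == 2], forall e : {set V}, #|e| = 2}.
Proof. by move=> e; rewrite inE => /eqP. Qed.

Definition complete_graph : sgraph V := SGraph complete_card2.

Definition is_complete (G : sgraph V) : Prop :=
  edges G = edges complete_graph.

Definition num_edges (G : sgraph V) : nat := #|edges G|.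

End Graphs.

Section EdgeColored.
Variables (C : eqType) (V : finType).
Implicit Type G : ecgraph C V.

Definition colors G : seq C := undup [seq color G e | e in edges G].

Definition num_colors G : nat := size (colors G).

Definition rainbow G (S : {set {set V}}) : Prop := {in S &, injective (color G)}.

Definition contains_rainbow (W : finType) (F : sgraph W) G : Prop :=
  exists f : W -> V,
    let copy := [set f @: e | e : {set W} in edges F] in
    [/\ injective f, copy \subset edges G & rainbow G copy].

End EdgeColored.

(* [g] is the renaming of colors; it matters only on the colors in use. *)
Definition ec_isomorphic (C C' : eqType) (V V' : finType)
    (G : ecgraph C V) (G' : ecgraph C' V') : Prop :=
  exists (f : V -> V') (g : C -> C'),
    [/\ bijective f,
        forall e : {set V}, (f @: e \in edges G') = (e \in edges G),
        {in colors G &, injective g}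
      & {in edges G, forall e : {set V}, color G' (f @: e) = g (color G e)}].

Section Turan.
Variables n q : nat.

Definition turan_edges : {set {set 'I_n}} :=
  [set [set x; y] | x in 'I_n, y in 'I_n & x != y %[mod q]].

Fact turan_card2 : {in turan_edges, forall e : {set 'I_n}, #|e| = 2}.
Proof.
move=> e /imset2P[x y _]; rewrite inE => /andP[_ xy] ->.
by rewrite cards2; case: (eqVneq x y) xy => // ->; rewrite eqxx.
Qed.

(* The partite sets are the residue classes modulo q; by [card_turan_part] below
   their sizes are as equal as possible. *)
Definition turan_graph : sgraph 'I_n := SGraph turan_card2.

Definition turan_num : nat := num_edges turan_graph.

Lemma card_turan_part (i : 'I_q) :
  #|[set x : 'I_n | x %% q == i]| = n %/ q + (i < n %% q).
Proof.
have q_gt0 : 0 < q by case: (q) i => // -[].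
rewrite cardsE -sum1_card (eq_bigl (fun x : 'I_n => x %% q == i)) //.
elim: n => [|m IHm]; first by rewrite big_ord0 div0n mod0n.
rewrite big_mkcond big_ord_recr -big_mkcond /= IHm.
have r_lt := ltn_pmod m q_gt0.
have [r1q | r1q] := eqVneq (m %% q).+1 q.
- have -> : m.+1 = (m %/ q).+1 * q by rewrite {1}(divn_eq m q) -addnS r1q mulSnr.
  rewrite mulnK // modnMl ltn0 addn0.
  have : i <= m %% q by rewrite -ltnS r1q.
  by case: ltngtP => // _ _; rewrite ?addn0 addn1.
have r1_lt : (m %% q).+1 < q by rewrite ltn_neqAle r1q.
have -> : m.+1 %/ q = m %/ q.
  by rewrite -add1n {1}(divn_eq m q) addnCA divnMDl // add1n (divn_small r1_lt) addn0.
have -> : m.+1 %% q = (m %% q).+1.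
  by rewrite -add1n {1}(divn_eq m q) addnCA modnMDl add1n (modn_small r1_lt).
by rewrite ltnS; case: ltngtP => // _; rewrite ?addn0 // addn1.
Qed.

(* Every edge of the spanning Turan graph is its own color [Some e], and [None]
   is the common color of the other edges. *)
Definition H_graph : ecgraph (option {set 'I_n}) 'I_n :=
  ECGraph (complete_graph 'I_n)
    (fun e => if e \in edges turan_graph then Some e else None).

End Turan.

(* T_{n,q} is a q-partite graph with nonempty parts only when 0 < q <= n, so
   this is meant for 2 < k <= #|V| + 2; k - 2 is a truncated subtraction. *)
Definition H_family (k : nat) (C : eqType) (V : finType) (H : ecgraph C V) :
    Prop :=
  let n := #|V| in
  ec_isomorphic H (H_graph n (k - 2)) \/
  [/\ n %/ (k - 2) = 1,
      is_complete H,
      num_colors H = turan_num n (k - 2) + 1,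
      contains_rainbow (turan_graph n (k - 2)) H
    & ~ contains_rainbow (complete_graph 'I_k) H].

(* Main.v *)
Require Import Defs.
From mathcomp Require Import all_boot.
From mathcomp Require Import zify.

Set Implicit Arguments.
Unset Strict Implicit.
Unset Printing Implicit Defensive.

(** Put q = k - 2 and let A be the vertex set, n = #|A|. If N is a set of pairs
    whose complement is rainbow and X meets every pair of N, then A minus X
    spans a rainbow clique.

    For q + 2 <= n <= 2q, choosing for N the complement of a transversal of the
    color classes and counting shows that G is complete and #|N| = n - q - 1; a
    vertex lying on two pairs of N would yield too small a cover, so N is a
    matching, whatever the transversal. Adding to N a pair of uncovered vertices
    gives a matching with rainbow complement T_{n,q}. When n = 2q, exchanging
    pairs of N for their representatives shows that this perfect matching is
    monochromatic, which is where q >= 4 enters.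

    For n > 2q one inducts on n. By averaging, some vertex v satisfies
    deg v + sat v <= 2 (n - 1) - (n - 1) %/ q, where sat v counts the colors seen
    only at v; hence G - v meets the bound and is H_{n-1,q}. The neighbors of v
    through private colors must miss a part entirely, for otherwise v and two
    vertices of one part and one of each other part span a rainbow clique. So
    they are exactly the vertices outside a smallest part, to which v is
    added; the edges from v to that part must have the common color. *)

(* [{set {set V}}] is elaborated with or without a reverse coercion on [{set V}];
   without this unfolding [lia] sees distinct cardinals. *)
Ltac card_lia := unfold reverse_coercion in *; simpl Finite.sort in *; lia.

(** * Transversals, pairs of vertices and covers *)

Lemma exists_transversal (S T : finType) (h : S -> T) (F : {set S}) :
  exists2 R : {set S}, R \subset F & {in R &, injective h} /\ h @: R = h @: F.
Proof.
pose r e := odflt e [pick f in F | h f == h e].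
have rP e : e \in F -> r e \in F /\ h (r e) = h e.
  by rewrite /r => Fe; case: pickP => [f /andP[Ff /eqP]|/(_ e)] //=; rewrite Fe eqxx.
have rE e f : e \in F -> f \in F -> h e = h f -> r e = r f.
  move=> Fe Ff hef; rewrite /r (eq_pick (_ : _ =1 [pred g in F | h g == h f])).
    by case: pickP => // /(_ f) /=; rewrite Ff eqxx.
  by move=> g /=; rewrite hef.
exists (r @: F); first by apply/subsetP => _ /imsetP[e Fe ->]; case: (rP e Fe).
split.
  move=> _ _ /imsetP[e Fe ->] /imsetP[f Ff ->].
  by have [[_ ->] [_ ->]] := (rP _ Fe, rP _ Ff); apply: rE.
apply/setP=> c; apply/imsetP/imsetP => [[_ /imsetP[e Fe ->] ->]|[e Fe ->]].
  by exists e => //; case: (rP e Fe).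
by exists (r e); [apply: imset_f | case: (rP e Fe)].
Qed.

Section Pairs.
Variable V : finType.
Implicit Types (A K X : {set V}) (e : {set V}).

Definition pairs A : {set {set V}} := [set e : {set V} | (e \subset A) && (#|e| == 2)].

Lemma card_pairs A : #|pairs A| = 'C(#|A|, 2).
Proof. by rewrite -cards_draws; apply: eq_card => e; rewrite !inE. Qed.

Lemma pairsP A e :
  reflect (exists x y, [/\ x \in A, y \in A, x != y & e = [set x; y]]) (e \in pairs A).
Proof.
rewrite inE; apply: (iffP andP) => [[sA /cards2P[x [y [xy eE]]]]|[x [y [Ax Ay xy ->]]]].
  by exists x, y; split=> //; apply: (subsetP sA); rewrite eE !inE eqxx ?orbT.
by rewrite cards2 xy; split=> //; apply/subsetP => z /set2P[]->.
Qed.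

Lemma pairsS A K : K \subset A -> pairs K \subset pairs A.
Proof.
by move=> sKA; apply/subsetP => e; rewrite !inE => /andP[sK ->]; rewrite (subset_trans sK).
Qed.

Lemma mem_pairs2 A x y : x \in A -> y \in A -> x != y -> [set x; y] \in pairs A.
Proof. by move=> Ax Ay xy; apply/pairsP; exists x, y. Qed.

(** Choose one vertex in each member of [N]. *)
Lemma exists_cover (N : {set {set V}}) :
  {in N, forall e : {set V}, e != set0} ->
  exists2 X : {set V}, #|X| <= #|N| & {in N, forall e : {set V}, ~~ [disjoint e & X]}.
Proof.
case: (pickP {: V}) => [v0 _|V0] N0; last first.
  by exists set0; rewrite ?cards0 // => e /N0/set0Pn[x]; have := V0 x.
pose h e := odflt v0 [pick x in e].
exists (h @: N) => [|e Ne]; first exact: leq_imset_card.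
have he : h e \in e.
  rewrite /h; case: pickP => [x //|e0]; have /set0Pn[x xe] := N0 _ Ne.
  by have := e0 x; rewrite xe.
by apply/pred0Pn; exists (h e); rewrite /= he imset_f.
Qed.

End Pairs.

(** * Rainbow cliques obtained by deleting a cover *)

Section RainbowCliques.
Variables V T : finType.
Implicit Types (A K X : {set V}) (E N : {set {set V}}) (col : {set V} -> T).

Definition rclique E col K : Prop :=
  pairs K \subset E /\ {in pairs K &, injective col}.

Lemma rclique_of_cover E col A N X :
  pairs A :\: N \subset E -> {in pairs A :\: N &, injective col} ->
  {in N, forall e : {set V}, ~~ [disjoint e & X]} -> rclique E col (A :\: X).
Proof.
move=> sE inj cov.
have s : pairs (A :\: X) \subset pairs A :\: N.
  apply/subsetP=> e eK; rewrite inE (subsetP (pairsS (subsetDl _ _)) _ eK) andbT.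
  apply/negP=> /cov /negP[]; move: eK; rewrite inE subsetD => /andP[/andP[_ //]].
split; first exact: subset_trans s sE.
by move=> e f /(subsetP s) eP /(subsetP s); apply: inj.
Qed.

Lemma card_setD_ge A X a : #|X| <= a -> #|A| <= #|A :\: X| + a.
Proof.
move=> Xa; rewrite -(cardsID X A) addnC leq_add2l (leq_trans _ Xa) //.
by rewrite subset_leq_card // subsetIr.
Qed.

(** Take a transversal [R] of the color classes and delete one vertex from each pair of [A] outside
    [R]; the pairs that survive all lie in [R], hence form a rainbow clique. *)
Lemma exists_rclique E col A :
  E \subset pairs A ->
  exists K, [/\ K \subset A, rclique E col K & #|A| + #|col @: E| <= #|K| + 'C(#|A|, 2)].
Proof.
move=> sE; have [R sR [injR colR]] : exists2 R : {set {set V}}, R \subset E &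
    {in R &, injective col} /\ col @: R = col @: E := exists_transversal col E.
have sRA := subset_trans sR sE.
have N0 : {in pairs A :\: R, forall e : {set V}, e != set0}.
  by move=> e /setDP[]; rewrite inE => /andP[_ /eqP e2] _; rewrite -card_gt0 e2.
have [X leX cov] := exists_cover N0.
have DR : pairs A :\: (pairs A :\: R) = R by rewrite setDDr setDv set0U; apply/setIidPr.
exists (A :\: X); split; first exact: subsetDl.
  by apply: rclique_of_cover cov; rewrite DR.
have := card_setD_ge A leX.
have := cardsID R (pairs A); rewrite (setIidPr sRA) card_pairs -colR (card_in_imset injR).
card_lia.
Qed.


(** The complement of [N] loses [f] and gains at most [e], which has the same color, so it stays
    rainbow. *)
Lemma swap_colored (P N : {set {set V}}) col e f :
  {in P :\: N &, injective col} -> e \in N -> f \in P -> f \notin N -> col e = col f ->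
  {in P :\: (f |: N :\ e) &, injective col}.
Proof.
move=> inj Ne Pf Nf cef.
have dec g : g \in P :\: (f |: N :\ e) -> g = e \/ [/\ g \in P :\: N, g != f & g != e].
  rewrite !inE negb_or negb_and negbK => /andP[/andP[gf] /orP[/eqP|Ng] Pg]; first by left.
  by right; rewrite gf Pg Ng; split=> //; apply: contraNneq Ng => ->.
have PNf : f \in P :\: N by rewrite inE Nf.
move=> g h /dec[->|[Pg gf ge]] /dec[->|[Ph hf he]] // cgh.
- by case/eqP: hf; apply: inj; rewrite // -cgh.
- by case/eqP: gf; apply: inj; rewrite // cgh.
- exact: inj.
Qed.

Section Complete.
Variables (A : {set V}) (p : nat) (col : {set V} -> T).
(** Consequently fewer than [p] vertices never cover a set of pairs whose complement is rainbow. *)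
Hypothesis norb :
  forall K, K \subset A -> {in pairs K &, injective col} -> #|K| + p <= #|A|.

(* A vertex common to two edges of [N] covers both, so that [p - 1] vertices
   would cover [N]. *)
Lemma complement_matching N :
  N \subset pairs A -> #|N| <= p -> {in pairs A :\: N &, injective col} ->
  {in N &, forall e f : {set V}, e != f -> [disjoint e & f]}.
Proof.
move=> sN leN inj e f Ne Nf ef; apply/negPn/negP => /pred0Pn[x /andP[/= xe xf]].
have N0 : {in N :\ e :\ f, forall e : {set V}, e != set0}.
  move=> g; rewrite !inE => /and3P[_ _ /(subsetP sN)]; rewrite inE => /andP[_ /eqP g2].
  by rewrite -card_gt0 g2.
have [X leX cov] := exists_cover N0.
have [|_ injK] := @rclique_of_cover (pairs A) col A N (x |: X) (subsetDl _ _) inj.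
  move=> g Ng; apply/pred0Pn.
  have [->|ge] := eqVneq g e; first by exists x; rewrite /= xe setU11.
  have [->|gf] := eqVneq g f; first by exists x; rewrite /= xf setU11.
  have /cov/pred0Pn[y /andP[/= yg yX]] : g \in N :\ e :\ f by rewrite !inE gf ge.
  by exists y; rewrite /= yg inE yX orbT.
have := norb (subsetDl _ _) injK.
have := @card_setD_ge A (x |: X) _ (leqnn _).
have := cardsU1 x X; have := cardsD1 e N; have := cardsD1 f (N :\ e).
by rewrite Ne !inE eq_sym ef Nf /=; case: (x \notin X) => /=; card_lia.
Qed.

(** Each pair of [N] has a representative of its color outside [N]. Swaps show that a representative
    shared by two pairs of [N] must be [[set y; z]], and that among any three pairs two share
    theirs. *)
Lemma complement_perfect_matching N (y z : V) :
  2 < p -> N \subset pairs A -> #|N| = p -> {in pairs A :\: N &, injective col} ->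
  col @: (pairs A :\: N) = col @: pairs A ->
  A \subset cover N :|: [set y; z] ->
  {in N, forall e : {set V}, col e = col [set y; z]}.
Proof.
move=> p3 sN cN inj colN sA.
have card2 e : e \in pairs A -> #|e| = 2 by rewrite inE => /andP[_ /eqP].
have sub2 e : e \in pairs A -> e \subset A by rewrite inE => /andP[].
have match1 := complement_matching sN (eq_leq cN) inj.
have rep e : e \in N -> exists f, [/\ f \in pairs A, f \notin N & col e = col f].
  move=> Ne; have : col e \in col @: (pairs A :\: N).
    by rewrite colN imset_f // (subsetP sN).
  by case/imsetP => f /setDP[? ?] ?; exists f.
have swapN N' e f : N' \subset pairs A -> #|N'| <= p -> e \in N' -> f \in pairs A -> f \notin N' ->
    f |: N' :\ e \subset pairs A /\ #|f |: N' :\ e| <= p.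
  move=> sN' leN' Ne Pf Nf; split.
    by rewrite subUset sub1set Pf (subset_trans (subsetDl _ _)).
  have := cardsD1 e N'; have := cardsU1 f (N' :\ e); rewrite Ne !inE (negbTE Nf) andbF /=; card_lia.
(* After the swap [f] belongs to a matching with the other pairs of [N], so it can only use vertices
   of [e] and the vertices [y], [z]. *)
have repS e f : e \in N -> f \in pairs A -> f \notin N -> col e = col f ->
    f \subset e :|: [set y; z].
  move=> Ne Pf Nf cef; have [sN' leN'] := swapN N e f sN (eq_leq cN) Ne Pf Nf.
  have match2 := complement_matching sN' leN' (swap_colored inj Ne Pf Nf cef).
  apply/subsetP=> x xf; have := subsetP sA x (subsetP (sub2 _ Pf) x xf).
  rewrite !inE => /orP[/bigcupP[g Ng xg]|->]; last by rewrite orbT.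
  have [<-|ge] := eqVneq g e; first by rewrite xg.
  have fg : f != g by apply: contraNneq Nf => ->.
  have Nf' : f \in f |: N :\ e by rewrite setU11.
  have Ng' : g \in f |: N :\ e by rewrite !inE ge Ng orbT.
  by have /pred0P/(_ x) := match2 _ _ Nf' Ng' fg; rewrite /= xf xg.
(* Two successive swaps put [f1] and [f2] into the same matching. *)
have repD e1 f1 e2 f2 :
    e1 \in N -> f1 \in pairs A -> f1 \notin N -> col e1 = col f1 ->
    e2 \in N -> f2 \in pairs A -> f2 \notin N -> col e2 = col f2 ->
    f1 != f2 -> [disjoint f1 & f2].
  move=> Ne1 Pf1 Nf1 c1 Ne2 Pf2 Nf2 c2 f12.
  have e12 : e2 != e1.
    apply: contraNneq f12 => e12; apply/eqP; apply: inj; rewrite ?in_setD ?Nf1 ?Nf2 //.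
    by rewrite -c1 -c2 e12.
  have [sN1 leN1] := swapN N e1 f1 sN (eq_leq cN) Ne1 Pf1 Nf1.
  have inj1 := swap_colored inj Ne1 Pf1 Nf1 c1.
  have Ne2' : e2 \in f1 |: N :\ e1 by rewrite !inE e12 Ne2 orbT.
  have Nf2' : f2 \notin f1 |: N :\ e1 by rewrite !inE (negbTE Nf2) andbF orbF eq_sym.
  have [sN2 leN2] := swapN _ e2 f2 sN1 leN1 Ne2' Pf2 Nf2'.
  have := complement_matching sN2 leN2 (swap_colored inj1 Ne2' Pf2 Nf2' c2).
  apply=> //; rewrite ?setU11 // !inE eqxx /= andbT.
  by rewrite (_ : f1 == e2 = false) ?orbT //; apply: contraNF Nf1 => /eqP->.
(* A representative avoiding both [y] and [z] would lie inside [e], hence equal [e]. *)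
have repM e f : e \in N -> f \in pairs A -> f \notin N -> col e = col f ->
    (y \in f) || (z \in f).
  move=> Ne Pf Nf cef; apply: contraNT (Nf); rewrite negb_or => /andP[yf zf].
  have fe : f \subset e.
    apply/subsetP => x xf; have := subsetP (repS _ _ Ne Pf Nf cef) x xf.
    by rewrite !inE => /or3P[//|/eqP xy|/eqP xz]; move: yf zf; rewrite -?xy -?xz xf.
  suff -> : f = e by [].
  by apply/eqP; rewrite eqEcard fe (card2 f) // (card2 e) // (subsetP sN).
(* Two disjoint edges of [N] sharing their representative force it to be {y, z}. *)
have same e1 e2 f : e1 \in N -> e2 \in N -> e1 != e2 -> f \in pairs A -> f \notin N ->
    col e1 = col f -> col e2 = col f -> f = [set y; z].
  move=> Ne1 Ne2 e12 Pf Nf c1 c2; apply/eqP; rewrite eqEcard (card2 f) // cards2.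
  rewrite (_ : f \subset _) ?ltnS ?leq_b1 //; apply/subsetP => x xf.
  have := subsetP (repS _ _ Ne1 Pf Nf c1) x xf; have := subsetP (repS _ _ Ne2 Pf Nf c2) x xf.
  rewrite !in_setU => /orP[x2|//] /orP[x1|//].
  by have /pred0P/(_ x) := match1 _ _ Ne1 Ne2 e12; rewrite /= x1 x2.
move=> e Ne; have [f [Pf Nf cef]] := rep e Ne; rewrite cef.
(* Here [2 < p] provides three pairs. Distinct representatives are disjoint and each meets
   [[set y; z]], so two of the three coincide. If only those of the other two pairs did, they would
   equal [[set y; z]], and [f] would miss it. *)
have [e' /setD1P[e'e Ne']] : exists e', e' \in N :\ e.
  by apply/set0Pn; rewrite -card_gt0; have := cardsD1 e N; rewrite Ne; card_lia.
have [e3 /setD1P[e3e' /setD1P[e3e Ne3]]] : exists e3, e3 \in N :\ e :\ e'.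
  apply/set0Pn; rewrite -card_gt0; have := cardsD1 e N; have := cardsD1 e' (N :\ e).
  by rewrite Ne !inE e'e Ne' /=; card_lia.
have [f' [Pf' Nf' ce'f']] := rep e' Ne'; have [f3 [Pf3 Nf3 c3]] := rep e3 Ne3.
have [ee' ee3 e'e3] : [/\ e != e', e != e3 & e' != e3] by split; rewrite eq_sym.
have [ff'|ff'] := eqVneq f f'.
  by rewrite (same e e' f Ne Ne' ee' Pf Nf cef) // ce'f' ff'.
have [ff3|ff3] := eqVneq f f3.
  by rewrite (same e e3 f Ne Ne3 ee3 Pf Nf cef) // c3 ff3.
have [f'f3|f'f3] := eqVneq f' f3.
  have f'yz : f' = [set y; z] by apply: (same e' e3) => //; rewrite c3 f'f3.
  have /pred0P D := repD _ _ _ _ Ne Pf Nf cef Ne' Pf' Nf' ce'f' ff'.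
  by case/orP: (repM _ _ Ne Pf Nf cef) => xf; have := D y; have := D z;
     rewrite /= f'yz !inE !eqxx xf ?orbT ?andbT.
have /pred0P D1 := repD _ _ _ _ Ne Pf Nf cef Ne' Pf' Nf' ce'f' ff'.
have /pred0P D2 := repD _ _ _ _ Ne Pf Nf cef Ne3 Pf3 Nf3 c3 ff3.
have /pred0P D3 := repD _ _ _ _ Ne' Pf' Nf' ce'f' Ne3 Pf3 Nf3 c3 f'f3.
have := D1 y; have := D1 z; have := D2 y; have := D2 z; have := D3 y; have := D3 z => /=.
have := repM _ _ Ne Pf Nf cef; have := repM _ _ Ne' Pf' Nf' ce'f'.
have := repM _ _ Ne3 Pf3 Nf3 c3.
by do 6!case: (_ \in _).
Qed.

End Complete.
End RainbowCliques.

(** * Balanced partitions and matchings *)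

Section Parts.
Variables V I : finType.
Implicit Types (A : {set V}) (e : {set V}) (p : V -> I) (i j : I).

Definition part A p i := [set x in A | p x == i].

Definition inside p e := [forall x in e, forall y in e, p x == p y].

(** Indexing the parts by the image of [A] makes all [q] of them nonempty. *)
Definition balanced q A p : Prop :=
  #|p @: A| = q /\ {in p @: A &, forall i j, #|part A p i| <= #|part A p j|.+1}.

Lemma inside2 p x y : inside p [set x; y] = (p x == p y).
Proof.
apply/forall_inP/eqP => [H|pxy u].
  by apply/eqP; have /forall_inP := H x (set21 x y); apply; rewrite set22.
by move=> /set2P[]-> ; apply/forall_inP => v /set2P[]->; rewrite ?pxy.
Qed.

Lemma sum_card_part A p : \sum_(i in p @: A) #|part A p i| = #|A|.
Proof.
rewrite -[RHS]sum1_card (partition_big_imset p) /=.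
apply: eq_bigr => i _; rewrite -sum1_card.
by apply: eq_bigl => x; rewrite inE.
Qed.

(** If one part has [s] vertices, the other [q - 1] have between [s - 1] and [s + 1]; summing puts
    [#|A|] between [q * s - (q - 1)] and [q * s + (q - 1)]. *)
Lemma card_part_balanced q A p i :
  0 < q -> balanced q A p -> i \in p @: A ->
  #|A| %/ q <= #|part A p i| <= (#|A| %/ q).+1.
Proof.
move=> q0 [cI bal] Ii; have := sum_card_part A p.
rewrite (bigD1 i) //= => sumE.
have cI1 : #|[pred j | (j \in p @: A) && (j != i)]| = q.-1.
  by rewrite -cI (cardD1 i (mem (p @: A))) Ii /=; apply: eq_card => j; rewrite !inE andbC.
have ub : #|A| <= #|part A p i| + q.-1 * (#|part A p i|).+1.
  rewrite -sumE leq_add2l -cI1 -sum_nat_const.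
  by apply: leq_sum => j /andP[Ij _]; apply: bal.
have lb : #|part A p i| + q.-1 * (#|part A p i|).-1 <= #|A|.
  rewrite -sumE leq_add2l -cI1 -sum_nat_const.
  apply: leq_sum => j /andP[Ij _]; have := bal _ _ Ii Ij; lia.
have := divn_eq #|A| q; have := ltn_pmod #|A| q0.
move: (#|A| %/ q) (#|A| %% q) (#|part A p i|) ub lb => b r s.
by case: q q0 {cI bal cI1} => // q _ /= ub lb rq En; apply/andP; split; nia.
Qed.

End Parts.

Section Matchings.
Variable V : finType.
Implicit Types (A : {set V}) (M : {set {set V}}).

Definition matching M := {in M &, forall e f : {set V}, e != f -> [disjoint e & f]}.

Lemma matching_trivIset M : matching M -> trivIset M.
Proof. by move=> mM; apply/trivIsetP. Qed.

Lemma card_cover_matching A M :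
  M \subset pairs A -> matching M -> #|cover M| = #|M|.*2.
Proof.
move=> sM /matching_trivIset /eqP <-; rewrite -muln2 -sum_nat_const.
by apply: eq_bigr => e /(subsetP sM); rewrite inE => /andP[_ /eqP].
Qed.

Lemma cover_matching_sub A M : M \subset pairs A -> cover M \subset A.
Proof.
by move=> sM; apply/bigcupsP => e /(subsetP sM); rewrite inE => /andP[].
Qed.

(** The parts are the pairs of [M] and the singletons of the uncovered vertices; each vertex is
    labeled by its own part. *)
Lemma matching_parts A M q :
  M \subset pairs A -> matching M -> #|M| + q = #|A| ->
  exists p : V -> {set V},
    balanced q A p /\ {in pairs A, forall e : {set V}, inside p e = (e \in M)}.
Proof.
move=> sM mM cM; have tI := matching_trivIset mM.
pose p x := if x \in cover M then pblock M x else [set x].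
have pxx x : x \in p x by rewrite /p; case: ifP => [|_]; rewrite ?set11 // -mem_pblock.
have pM x : x \in cover M -> p x \in M by rewrite /p => xM; rewrite xM pblock_mem.
have pE x y : (p y == p x) = (y \in p x).
  apply/eqP/idP => [<- //|]; rewrite /p; case: (boolP (x \in cover M)) => xM.
    move=> yx; have yM : y \in cover M by apply/bigcupP; exists (pblock M x); rewrite ?pblock_mem.
    by rewrite yM; apply: same_pblock.
  by rewrite inE => /eqP->; rewrite (negbTE xM).
have pA x : x \in A -> p x \subset A.
  rewrite /p; case: ifP => xM xA; last by rewrite sub1set.
  by have := subsetP sM _ (pblock_mem xM); rewrite inE => /andP[].
have partE x : x \in A -> part A p (p x) = p x.
  move=> xA; apply/setP => y; rewrite inE pE andb_idl //.
  exact: (subsetP (pA x xA)).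
have cp x : 0 < #|p x| <= 2.
  rewrite /p; case: ifP => xM; last by rewrite cards1.
  by have := subsetP sM _ (pblock_mem xM); rewrite inE => /andP[_ /eqP->].
exists p; split; last first.
  move=> e /pairsP[x [y [xA yA xy ->]]]; rewrite inside2 pE.
  apply/idP/idP => [xy'|eM].
    have yM : y \in cover M.
      by apply: contraLR xy' => yM; rewrite /p (negbTE yM) inE.
    suff -> : [set x; y] = p y by apply: pM.
    have cpy : #|p y| = 2.
      by have := subsetP sM _ (pM _ yM); rewrite inE => /andP[_ /eqP].
    by apply/eqP; rewrite eqEcard cpy cards2 xy subUset !sub1set xy' pxx.
  have yM : y \in cover M by apply/bigcupP; exists [set x; y]; rewrite ?set22.
  by rewrite /p yM (def_pblock tI eM) ?set21 ?set22.
split; last first.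
  move=> _ _ /imsetP[x xA ->] /imsetP[y yA ->]; rewrite !partE //.
  by have := cp x; have := cp y; lia.
have -> : p @: A = M :|: [set [set x] | x in A :\: cover M].
  apply/setP=> e; apply/imsetP/setUP => [[x xA ->]|[eM|/imsetP[x /setDP[xA xM] ->]]].
  - have [xM|xM] := boolP (x \in cover M); [left; exact: pM|right].
    by rewrite /p (negbTE xM) imset_f // inE xM.
  - have := subsetP sM _ eM; rewrite inE => /andP[eA /eqP e2].
    have /set0Pn[x xe] : e != set0 by rewrite -card_gt0 e2.
    exists x; first exact: (subsetP eA).
    have xM : x \in cover M by apply/bigcupP; exists e.
    by rewrite /p xM (def_pblock tI eM).
  - by exists x; rewrite // /p (negbTE xM).
have D : [disjoint M & [set [set x] | x in A :\: cover M]].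
  apply/pred0P=> e; apply/negbTE/negP => /andP[/= eM /imsetP[x /setDP[_ /negP xM] eE]].
  by apply: xM; apply/bigcupP; exists e; rewrite // eE set11.
rewrite cardsU disjoint_setI0 // cards0 subn0 card_imset; last exact: set1_inj.
have := card_cover_matching sM mM; have := cardsID (cover M) A.
by rewrite (setIidPr (cover_matching_sub sM)); card_lia.
Qed.

End Matchings.

(** * Orders from [q + 2] to [2q] *)

Section SmallOrder.
Variables V T : finType.
Implicit Types (A K : {set V}) (E : {set {set V}}) (col : {set V} -> T).

(** The clique of [exists_rclique] bounds the number of colors and [pairs A] bounds the number of
    edges; the hypothesis makes both bounds tight. *)
Lemma small_order_complete q E col A :
  E \subset pairs A -> q.+2 <= #|A| ->
  ('C(#|A|, 2)).*2.+1 + q <= #|E| + #|col @: E| + #|A| ->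
  (forall K, K \subset A -> rclique E col K -> #|K| <= q.+1) ->
  E = pairs A /\ #|col @: E| + #|A| = 'C(#|A|, 2) + q.+1.
Proof.
move=> sE qn ge norb; have [K [sK rK cK]] := exists_rclique col sE.
have := norb _ sK rK; have := subset_leq_card sE; rewrite card_pairs => leE leK.
have : #|E| = #|pairs A| by rewrite card_pairs; card_lia.
move=> cE; split; last by rewrite card_pairs in cE; card_lia.
by apply/eqP; rewrite eqEcard sE cE leqnn.
Qed.

(** The pairs outside a transversal of the colors form a matching [N] with [p] members, and [M] adds
    to it a pair of uncovered vertices. *)
Lemma small_order_matching q col A :
  q.+2 <= #|A| <= q.*2 ->
  #|col @: pairs A| + #|A| = 'C(#|A|, 2) + q.+1 ->
  (forall K, K \subset A -> rclique (pairs A) col K -> #|K| <= q.+1) ->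
  exists M : {set {set V}}, [/\ M \subset pairs A, matching M, #|M| + q = #|A|,
    {in pairs A :\: M &, injective col}
  & 3 < q -> #|A| = q.*2 -> {in M &, forall e f : {set V}, col e = col f}
       /\ {in M & pairs A, forall e f : {set V}, col e = col f -> f \in M}].
Proof.
move=> /andP[nq n2q] cc norb'.
have [R sR [injR colR]] : exists2 R : {set {set V}}, R \subset pairs A &
    {in R &, injective col} /\ col @: R = col @: pairs A := exists_transversal col _.
have [p pE] : exists p, p + q.+1 = #|A| by exists (#|A| - q.+1); rewrite subnK // ltnW.
pose N := pairs A :\: R.
have RE : pairs A :\: N = R by rewrite setDDr setDv set0U; apply/setIidPr.
have norb K : K \subset A -> {in pairs K &, injective col} -> #|K| + p <= #|A|.
  move=> sK iK; have := norb' K sK (conj (pairsS sK) iK); move: pE; clear; lia.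
have sN : N \subset pairs A := subsetDl _ _.
have cN : #|N| = p.
  have := cardsID R (pairs A); rewrite (setIidPr sR) card_pairs -(card_in_imset injR) colR.
  by move: cc pE; rewrite -/N; clear; card_lia.
have mN : matching N by apply: (complement_matching norb sN); rewrite ?cN ?RE.
have cU : #|A :\: cover N| = #|A| - p.*2.
  by rewrite cardsD (setIidPr (cover_matching_sub sN)) (card_cover_matching sN mN) cN.
(* At least two vertices are uncovered: with [n = #|A|] and [p = n - q - 1], their number [n - 2p]
   equals [2q + 2 - n], and [n <= 2q]. *)
have [y yU] : exists y, y \in A :\: cover N.
  by apply/set0Pn; rewrite -card_gt0 cU; move: pE n2q; clear; lia.
have [z zU] : exists z, z \in (A :\: cover N) :\ y.
  apply/set0Pn; rewrite -card_gt0; have := cardsD1 y (A :\: cover N).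
  by rewrite yU cU; move: pE n2q; clear; lia.
have [yA yN] := setDP yU; have [zy /setDP[zA zN]] := setD1P zU.
have yzP : [set y; z] \in pairs A by rewrite mem_pairs2 // eq_sym.
have yzN : [set y; z] \notin N.
  by apply: contra yN => yzN; apply/bigcupP; exists [set y; z]; rewrite ?set21.
have yzD e : e \in N -> [disjoint [set y; z] & e].
  move=> eN; apply/pred0P=> x; apply/negbTE/negP=> /andP[/= /set2P[]-> xe].
    by case/negP: yN; apply/bigcupP; exists e.
  by case/negP: zN; apply/bigcupP; exists e.
have injM : {in pairs A :\: ([set y; z] |: N) &, injective col}.
  have s : pairs A :\: ([set y; z] |: N) \subset R by rewrite -RE setDS ?subsetUr.
  by move=> e f /(subsetP s) eR /(subsetP s); apply: injR.
exists ([set y; z] |: N); split=> //.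
- by rewrite subUset sub1set yzP.
- move=> e f /setU1P[->|eN] /setU1P[->|fN]; rewrite ?eqxx //.
  + by move=> _; apply: yzD.
  + by move=> _; rewrite disjoint_sym; apply: yzD.
  + exact: mN.
- by rewrite cardsU1 yzN cN -pE; clear; lia.
move=> q3 cA.
have yzcol e : e \in [set y; z] |: N -> col e = col [set y; z].
  case/setU1P => [->//|]; apply: (complement_perfect_matching norb) => //.
  - by move: pE q3; rewrite cA; clear; lia.
  - by rewrite RE.
  - by rewrite RE.
  - apply/subsetP=> x xA; rewrite in_setU; case: (boolP (x \in cover N)) => //= xN.
    have /eqP -> : [set y; z] == A :\: cover N; last by rewrite inE xN.
    rewrite eqEcard subUset !sub1set yU !inE zA zN cards2 eq_sym zy cU /=.
    by move: pE; rewrite cA; clear; lia.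
split=> [e f /yzcol-> /yzcol-> //|e f /yzcol-> fP cf].
(* Since [[set y; z]] represents its color in [R], every other pair of that color lies in [N]. *)
have [fN|fN] := boolP (f \in N); first by rewrite inE fN orbT.
have fR : f \in R by rewrite -RE inE fN.
have yzR : [set y; z] \in R by rewrite -RE inE yzN.
by rewrite -(injR _ _ yzR fR cf) setU11.
Qed.

End SmallOrder.

(** * Averaging and the upper bound *)

(* The number of edges missing from the Turan graph T_{n,q}. *)
Definition turan_gap q n := \sum_(i < n) i %/ q.

Lemma turan_gapS q n : turan_gap q n.+1 = turan_gap q n + n %/ q.
Proof. exact: big_ord_recr. Qed.

(** Both sides are the sum of the squared part sizes of T_{n+1,q}, which has [n %% q + 1] parts of
    size [n %/ q + 1] and otherwise parts of size [n %/ q]. *)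
Lemma turan_gapE q n : 0 < q ->
  n.+1 + (turan_gap q n.+1).*2 = n.+1 * (n %/ q) + (n %/ q).+1 * (n %% q).+1.
Proof.
move=> q0; elim: n => [|n IH].
  by rewrite turan_gapS /turan_gap big_ord0 div0n mod0n.
rewrite turan_gapS; have := divn_eq n.+1 q; have := ltn_pmod n.+1 q0.
have := divn_eq n q; have := ltn_pmod n q0; move: IH.
move: (n %/ q) (n %% q) (n.+1 %/ q) (n.+1 %% q) (turan_gap q n.+1) => b r b' r' d.
move=> IH rq En r'q En'.
have [bb|bb] : b' = b /\ r' = r.+1 \/ b' = b.+1 /\ r' = 0 /\ q = r.+1.
  have b1 : b <= b' by rewrite -ltnS -(ltn_pmul2r q0); lia.
  have b2 : b' < b.+2 by rewrite -(ltn_pmul2r q0); lia.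
  have [E|E] : b' = b \/ b' = b.+1 by lia.
    by left; subst b'; lia.
  by right; subst b'; lia.
  case: bb => -> ->; lia.
case: bb => -> [-> qE]; subst q; nia.
Qed.

(** In this range the parts have one or two vertices, so the missing edges form a matching of size
    [n - q]. *)
Lemma turan_gap_small q n : 0 < q -> q <= n <= q.*2 -> turan_gap q n + q = n.
Proof.
move=> q0; case: n => [|n]; first lia.
have := turan_gapE n q0; have := divn_eq n q; have := ltn_pmod n q0.
move: (n %/ q) (n %% q) (turan_gap q n.+1) => b r d rq.
case: b => [|[|b]]; [lia | lia | nia].
Qed.

Lemma leq_turan_gap q n : turan_gap q n <= 'C(n, 2).
Proof. by rewrite -bin2_sum big_mkord leq_sum // => i _; apply: leq_div. Qed.

Section Stars.
Variable V : finType.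
Implicit Types (A : {set V}) (F : {set {set V}}).

Lemma pairsU1 A v e : e \in pairs (v |: A) ->
  e \in pairs A \/ exists2 x, x \in A & e = [set v; x].
Proof.
case/pairsP=> x [y [/setU1P[->|xA] /setU1P[->|yA] xy ->]].
- by rewrite eqxx in xy.
- by right; exists y.
- by right; exists x; rewrite // setUC.
- by left; rewrite mem_pairs2.
Qed.

Lemma set2_inj (v x y : V) : x != v -> [set v; x] = [set v; y] -> x = y.
Proof. by move=> xv /setP/(_ x); rewrite !inE eqxx orbT (negbTE xv) => /esym/eqP. Qed.

Lemma card_star A v F : v \notin A -> F \subset pairs (v |: A) ->
  {in F, forall e : {set V}, v \in e} -> #|F| = #|[set x in A | [set v; x] \in F]|.
Proof.
move=> vA sF vF; have -> : F = [set [set v; x] | x in [set x in A | [set v; x] \in F]].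
  apply/setP=> e; apply/idP/imsetP => [eF|[x]]; last by rewrite inE => /andP[_ ?] ->.
  have [eA|[x xA eE]] := pairsU1 (subsetP sF _ eF).
    by move: eA vA; rewrite inE => /andP[/subsetP/(_ _ (vF _ eF))->].
  by exists x; rewrite // inE xA -eE.
rewrite card_in_imset; last first.
  move=> x y; rewrite inE => /andP[xA _] _; apply: set2_inj.
  by apply: contraNneq vA => <-.
congr #|pred_of_set _|; apply/setP=> x; rewrite !inE; case: (boolP (x \in A)) => //= xA.
apply/idP/imsetP => [xF|[y]]; first by exists x; rewrite // inE xA.
by rewrite inE => /andP[_ ?] ->.
Qed.

End Stars.

Section Averaging.
Variables V T : finType.
Implicit Types (A K : {set V}) (E : {set {set V}}) (col : {set V} -> T).

Definition edges_at E v : {set {set V}} := [set e in E | v \in e].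
Definition edges_off E v : {set {set V}} := [set e in E | v \notin e].

(** Double counting: an edge is seen from its two ends, and a color can be private only to the ends
    of any one edge bearing it. *)
Lemma sum_edges_at E col A :
  E \subset pairs A ->
  \sum_(v in A) (#|edges_at E v| + #|col @: E :\: col @: edges_off E v|)
    <= (#|E| + #|col @: E|).*2.
Proof.
move=> sE; rewrite big_split doubleD /= leq_add //.
  rewrite (eq_bigr (fun v => \sum_(e in E) (v \in e))) => [|v _]; last first.
    rewrite -sum1_card -big_mkcondr /=; apply: eq_bigl => e; by rewrite inE.
  rewrite exchange_big /= -muln2 -sum_nat_const leq_sum // => e /(subsetP sE).
  rewrite inE => /andP[_ /eqP <-]; rewrite -sum1_card big_mkcond [leqRHS]big_mkcond.
  by rewrite leq_sum // => v _; case: (v \in A); case: (v \in e).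
rewrite (eq_bigr (fun v => \sum_(c in col @: E) (c \notin col @: edges_off E v))) => [|v _]; last first.
  rewrite -sum1_card -big_mkcondr /=; apply: eq_bigl => c; by rewrite inE andbC.
rewrite exchange_big /= -muln2 -sum_nat_const leq_sum // => _ /imsetP[e eE ->].
have := subsetP sE _ eE; rewrite inE => /andP[_ /eqP <-].
rewrite -sum1_card big_mkcond [leqRHS]big_mkcond leq_sum // => v _.
case: (v \in A) => //; case: (boolP (v \in e)) => [_|ve]; first by case: (_ \notin _).
by rewrite imset_f // inE eE.
Qed.

(** If every vertex violated the inequality, the sum over all vertices would exceed twice the number
    of edges and colors. *)
Lemma exists_light_vertex q E col A n :
  0 < q -> q.*2 <= n -> #|A| = n.+1 -> E \subset pairs A ->
  #|E| + #|col @: E| + turan_gap q n.+1 = ('C(n.+1, 2)).*2.+1 ->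
  exists2 v, v \in A &
    #|edges_at E v| + #|col @: E :\: col @: edges_off E v| + n %/ q <= n.*2.
Proof.
move=> q0 q2n cA sE eqE.
have [/existsP[v /andP[vA Hv]]|] := boolP [exists v, (v \in A) &&
    (#|edges_at E v| + #|col @: E :\: col @: edges_off E v| + n %/ q <= n.*2)].
  by exists v.
rewrite negb_exists => /forallP H.
have : \sum_(v in A) (n.*2.+1 - n %/ q) <= (#|E| + #|col @: E|).*2.
  apply: leq_trans (sum_edges_at col sE); apply: leq_sum => v vA.
  by have := H v; rewrite vA /= -ltnNge; lia.
rewrite sum_nat_const cA => le1.
have C2 : ('C(n.+1, 2)).*2 = n.+1 * n by rewrite -mul2n -mul_bin_diag bin1.
have := turan_gapE n q0; have sn : n %/ q <= n := leq_div n q.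
(* With [s = n %/ q] and [r = n %% q], the excess is [(s + 1) * (r + 1) - 2], which is positive
   because [s >= 2]. *)
have s2 : 2 <= n %/ q by rewrite leq_divRL // mul2n.
move: (n %/ q) (n %% q) (turan_gap q n.+1) (#|E| + #|col @: E|) eqE le1 C2 sn s2.
move=> s r d mc ? ? ? ? ? ?; nia.
Qed.

End Averaging.

Section UpperBound.
Variables V T : finType.
Implicit Types (A K : {set V}) (E : {set {set V}}) (col : {set V} -> T).

Lemma rcliqueW E E' col col' K :
  E' \subset E -> (forall e f, col e = col f -> col' e = col' f) ->
  rclique E' col' K -> rclique E col K.
Proof.
move=> sE cc [sK inj]; split; first exact: subset_trans sE.
by move=> e f eK fK /cc; apply: inj.
Qed.

(** Keep [j] of the colors and merge all the others into one of these. *)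
Lemma exists_coarser_coloring E col j :
  0 < j <= #|col @: E| ->
  exists2 col' : {set V} -> T, forall e f, col e = col f -> col' e = col' f
    & #|col' @: E| = j.
Proof.
case/andP=> j0 jc; pose S := [set c in take j (enum (col @: E))].
have cS : #|S| = j.
  rewrite cardsE; have /card_uniqP -> := take_uniq j (enum_uniq (col @: E)).
  by rewrite size_takel // -cardE.
have [c0 c0S] : exists c, c \in S by apply/set0Pn; rewrite -card_gt0 cS.
exists (fun e => if col e \in S then col e else c0) => [e f ->//|].
rewrite -[RHS]cS; apply: eq_card => c; apply/imsetP/idP => [[e _ ->]|cS'].
  by case: ifP.
have : c \in col @: E by move: cS'; rewrite inE => /mem_take; rewrite mem_enum.
by case/imsetP=> e eE cE; exists e; rewrite // -cE cS'.
Qed.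

(* Deleting an edge of a repeated color, or merging colors, lowers [m + c]
   while creating no rainbow clique; so beyond the bound one would reach an
   incomplete graph meeting the bound. *)
Lemma tight_of_complete q A :
  q.+2 <= #|A| ->
  (forall E col, E \subset pairs A ->
     #|E| + #|col @: E| + turan_gap q #|A| = ('C(#|A|, 2)).*2.+1 ->
     (forall K, K \subset A -> rclique E col K -> #|K| <= q.+1) -> E = pairs A) ->
  forall E col, E \subset pairs A ->
    ('C(#|A|, 2)).*2.+1 <= #|E| + #|col @: E| + turan_gap q #|A| ->
    (forall K, K \subset A -> rclique E col K -> #|K| <= q.+1) ->
    #|E| + #|col @: E| + turan_gap q #|A| = ('C(#|A|, 2)).*2.+1.
Proof.
move=> qA compl E col sE ge norb; apply/eqP; rewrite eqn_leq ge andbT leqNgt.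
apply/negP=> gt.
(* If [E] is complete it cannot be rainbow, as [#|A|] exceeds [q + 1]; deleting one of two edges of
   equal color then costs exactly one. *)
have [F [sF FE geF]] : exists F : {set {set V}}, [/\ F \subset E, F != pairs A &
    ('C(#|A|, 2)).*2.+1 <= #|F| + #|col @: F| + turan_gap q #|A|].
  have [EA|EA] := eqVneq E (pairs A); last by exists E.
  have [/dinjectiveP inj|/dinjectivePn[e eE [f /andP[fe fE] cef]]] := boolP (dinjectiveb col (mem E)).
    rewrite ltnNge in qA; case/negP: qA; apply: norb => //.
    by split; [rewrite EA | move: inj; rewrite EA].
  exists (E :\ e); split; first exact: subD1set.
    by apply: contraTneq eE => EeA; rewrite EA -EeA !inE eqxx.
  have -> : col @: (E :\ e) = col @: E.
    apply/eqP; rewrite eqEsubset imsetS ?subD1set //=.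
    apply/subsetP=> _ /imsetP[g gE ->]; have [->|ge'] := eqVneq g e.
      by rewrite cef imset_f // !inE fe.
    by rewrite imset_f // !inE ge'.
  by have := cardsD1 e E; rewrite eE; card_lia.
(* These two bounds make the number of colors requested below positive. *)
have leF : #|F| <= 'C(#|A|, 2) by rewrite -card_pairs subset_leq_card // (subset_trans sF).
have leD := leq_turan_gap q #|A|.
case: (@exists_coarser_coloring F col (('C(#|A|, 2)).*2.+1 - #|F| - turan_gap q #|A|)).
  by card_lia.
move=> col' cc cF; case/eqP: FE; apply: (compl F col').
- exact: subset_trans sE.
- by rewrite cF; card_lia.
- by move=> K sK /(rcliqueW sF cc); apply: norb.
Qed.

End UpperBound.

(** * Extending H_{n-1,q} by a vertex *)

Section TuranColored.
Variables V T : finType.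
Implicit Types (A K : {set V}) (E : {set {set V}}) (col : {set V} -> T).

(* [H_{n,q}] on the vertex set [A], with partite sets the fibers of [p]. *)
Definition turan_colored q E col A : Prop :=
  exists p : V -> {set V},
    [/\ E = pairs A, balanced q A p
      & {in pairs A &, forall e f : {set V},
           (col e == col f) = (e == f) || inside p e && inside p f}].

Lemma rclique_cone E col v B :
  pairs B \subset E ->
  {in B, forall x, [set v; x] \in E} ->
  {in pairs B &, injective col} ->
  {in B &, forall x y, col [set v; x] = col [set v; y] -> x = y} ->
  {in B & pairs B, forall x e, col [set v; x] <> col e} ->
  rclique E col (v |: B).
Proof.
move=> sB vB injB injv disj; split.
  by apply/subsetP=> e /pairsU1[/(subsetP sB)|[x xB ->]] //; apply: vB.
move=> e f /pairsU1[eB|[x xB ->]] /pairsU1[fB|[y yB ->]].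
- exact: injB.
- by move/esym/disj => /(_ yB eB).
- by move/disj => /(_ xB fB).
- by move/injv => ->.
Qed.

Section Book.
Variables (q : nat) (p : V -> {set V}) (A : {set V}) (r : {set V} -> V) (z : V).
Hypothesis rP : {in p @: A, forall i, r i \in A /\ p (r i) = i}.
Hypotheses (zA : z \in A) (zr : z != r (p z)).

(** A transversal of the parts together with a second vertex [z] of one part. It is rainbow in
    H_{n,q}, although it has one vertex more than there are parts. *)
Let B := z |: r @: (p @: A).

Lemma book_sub : B \subset A.
Proof.
by rewrite subUset sub1set zA; apply/subsetP=> _ /imsetP[i iI ->]; case: (rP iI).
Qed.

Lemma mem_book x : x \in B -> x = z \/ x = r (p x).
Proof. by case/setU1P=> [|/imsetP[i iI ->]]; [left | right; case: (rP iI) => _ ->]. Qed.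

Lemma card_book : #|B| = #|p @: A|.+1.
Proof.
rewrite cardsU1 card_in_imset => [|i j iI jI rij]; last first.
  by case: (rP iI) => _ <-; rewrite rij; case: (rP jI).
suff -> : z \notin r @: (p @: A) by [].
apply: contra zr => /imsetP[i iI zE]; rewrite {1}zE.
by case: (rP iI) => _ {1}<-; rewrite zE; case: (rP iI) => _ ->.
Qed.

(** Every vertex of [B] other than [z] is the chosen representative of its part. *)
Lemma inside_book e : e \in pairs B -> inside p e -> e = [set z; r (p z)].
Proof.
case/pairsP=> x [y [/mem_book xB /mem_book yB xy ->]]; rewrite inside2 => /eqP pxy.
case: xB => xE; case: yB => yE.
- by case/eqP: xy; rewrite xE yE.
- by rewrite yE -pxy xE.
- by rewrite xE pxy yE setUC.
- by case/eqP: xy; rewrite xE pxy.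
Qed.

End Book.

Lemma inside_pairs (p : V -> {set V}) A i :
  2 <= #|part A p i| -> exists2 e, e \in pairs A & inside p e.
Proof.
case/card_gt1P=> x [y []]; rewrite !inE => /andP[xA /eqP px] /andP[yA /eqP py] xy.
by exists [set x; y]; rewrite ?mem_pairs2 // inside2 px py.
Qed.

Section Extend.
Variables (q : nat) (E : {set {set V}}) (col : {set V} -> T) (A : {set V}) (v : V).
Hypotheses (q3 : 2 < q) (q2A : q.*2 <= #|A|) (vA : v \notin A).
Hypothesis sE : E \subset pairs (v |: A).
Hypothesis norb : forall K, K \subset v |: A -> rclique E col K -> #|K| <= q.+1.
Hypothesis degv :
  #|edges_at E v| + #|col @: E :\: col @: edges_off E v| + #|A| %/ q = #|A|.*2.
Variable p : V -> {set V}.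
Hypothesis offE : edges_off E v = pairs A.
Hypothesis bal : balanced q A p.
Hypothesis colA : {in pairs A &, forall e f : {set V},
  (col e == col f) = (e == f) || inside p e && inside p f}.

Let s := #|A| %/ q.
Let I := p @: A.

Lemma size_parts i : i \in I -> s <= #|part A p i| <= s.+1.
Proof. by apply: card_part_balanced => //; lia. Qed.

Lemma size_part_ge2 i : i \in I -> 2 <= #|part A p i|.
Proof.
move=> /size_parts/andP[le _]; apply: leq_trans le.
by rewrite leq_divRL ?mul2n //; lia.
Qed.

Lemma pairs_subE : pairs A \subset E.
Proof. by rewrite -offE; apply/subsetP=> e; rewrite inE => /andP[]. Qed.

(** [R] contains one edge for each color that is seen only at [v]. *)
Lemma star_set : exists R : {set {set V}},
  [/\ R \subset E, {in R &, injective col},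
      {in R & pairs A, forall e f, col e <> col f}
    & #|[set x in A | [set v; x] \in R]| = #|col @: E :\: col @: pairs A|].
Proof.
pose F := [set e in edges_at E v | col e \notin col @: pairs A].
have [R sR [injR colR]] : exists2 R : {set {set V}}, R \subset F &
    {in R &, injective col} /\ col @: R = col @: F := exists_transversal col F.
have RE e : e \in R -> [/\ e \in E, v \in e & col e \notin col @: pairs A].
  by move/(subsetP sR); rewrite !inE => /andP[/andP[-> ->] ->].
exists R; split=> //.
- by apply/subsetP=> e /RE[].
- by move=> e f /RE[_ _ ce] fA cef; rewrite cef imset_f in ce.
rewrite -card_star //; last by move=> e /RE[].
  rewrite -(card_in_imset injR) colR; congr #|pred_of_set _|.
  apply/setP=> c; rewrite inE; apply/imsetP/andP => [[e]|[cA /imsetP[e eE ce]]].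
    by rewrite !inE -andbA => /and3P[eE _ ce] ->; rewrite ce imset_f.
  exists e => //; rewrite !inE eE -ce cA andbT /=.
  apply: contraR cA => ve; rewrite ce imset_f // -offE inE eE; exact: ve.
by apply: subset_trans sE; apply/subsetP=> e /RE[].
Qed.

Lemma card_edges_at : #|edges_at E v| = #|[set x in A | [set v; x] \in E]|.
Proof.
rewrite (@card_star _ A v) //.
- congr #|pred_of_set _|; apply/setP=> x; rewrite !inE eqxx andbT //.
- by apply: subset_trans sE; apply/subsetP=> e; rewrite inE => /andP[].
- by move=> e; rewrite inE => /andP[].
Qed.

(** Adding [v] to [B] would give a rainbow clique on at least [q + 2] vertices. *)
Lemma no_cone (B : {set V}) :
  B \subset A -> q < #|B| -> {in pairs B &, injective col} ->
  {in B, forall x, [set v; x] \in E} ->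
  {in B &, forall x y, col [set v; x] = col [set v; y] -> x = y} ->
  {in B & pairs B, forall x e, col [set v; x] <> col e} -> False.
Proof.
move=> sB cB injB vB injv disj; have vnB : v \notin B by apply: contra vA; apply: (subsetP sB).
have sBE : pairs B \subset E := subset_trans (pairsS sB) pairs_subE.
have := norb _ (rclique_cone sBE vB injB injv disj).
by rewrite setUS // cardsU1 vnB => /(_ isT); lia.
Qed.

(* In a book the only pair inside a part is the spine {z, r (p z)}. *)
Lemma book_injective r z :
  {in I, forall i, r i \in A /\ p (r i) = i} -> z \in A -> z != r (p z) ->
  {in pairs (z |: r @: I) &, injective col}.
Proof.
move=> rP zA zr e f eB fB /eqP.
have sB := pairsS (book_sub rP zA).
rewrite colA ?(subsetP sB) // => /orP[/eqP //|/andP[ie jf]].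
by rewrite (inside_book rP eB ie) (inside_book rP fB jf).
Qed.

Lemma extend_turan_colored : turan_colored q E col (v |: A).
Proof.
have [R [sR injR disjR cS]] := star_set.
set S := [set x in A | _] in cS.
have sSA : S \subset A by apply/subsetP=> x; rewrite inE => /andP[].
have SP x : x \in S -> [set v; x] \in R by rewrite inE => /andP[].
have vneq x : x \in A -> x != v by move=> xA; apply: contraNneq vA => <-.
have vinj x y : x \in A -> [set v; x] = [set v; y] -> x = y by move=> /vneq; apply: set2_inj.
set N := [set x in A | [set v; x] \in E].
have sNA : N \subset A by apply/subsetP=> x; rewrite inE => /andP[].
have leN := subset_leq_card sNA.
have degv' : #|N| + #|S| + s = #|A|.*2 by rewrite -card_edges_at cS -offE.
have cI : #|I| = q by case: bal.
have pI x : x \in A -> p x \in I by move=> xA; apply: imset_f.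
have chooseP i : i \in I -> exists2 x, x \in A & p x = i.
  by case/imsetP=> x xA ->; exists x.
(* Some part misses [S]. Otherwise a book can be chosen inside [S], and its edges to [v] have
   distinct private colors. *)
have [j jI Sj] : exists2 j, j \in I & {in S, forall x, p x != j}.
  have [/existsP[j /andP[jI /forall_inP H]]|] :=
    boolP [exists j, (j \in I) && [forall x in S, p x != j]]; first by exists j.
  rewrite negb_exists => /forallP H.
  have meet i : i \in I -> exists2 x, x \in S & p x = i.
    move=> iI; have := H i; rewrite iI /= => /forall_inPn[x xS].
    by rewrite negbK => /eqP; exists x.
  (* By [degv'], [#|S|] is at least [#|A| - s], that is [(q - 1) * s] plus a remainder, with
     [s >= 2] and [q >= 3]. *)
  have qS : q < #|S|.
    have := divn_eq #|A| q; have : #|A| %% q < q by rewrite ltn_mod; lia.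
    move: degv' leN q2A; rewrite -/s; move: (#|A| %% q) => r; clear -q3.
    move: s #|A| #|S| #|N| => s' a b c; nia.
  have [/dinjectiveP injp|/dinjectivePn[x xS [y /andP[/= yx yS] pxy]]] :=
    boolP (dinjectiveb p (mem S)).
    suff : #|S| <= q by rewrite leqNgt qS.
    by rewrite -cI -(card_in_imset injp) subset_leq_card // imsetS.
  (* The part shared by [x] and [y] is represented by [x], which leaves [y] as the extra vertex. *)
  pose r i := if i == p x then x else odflt x [pick x in S | p x == i].
  have rS i : i \in I -> r i \in S /\ p (r i) = i.
    move=> iI; rewrite /r; have [->//|_] := eqVneq i (p x).
    have [u uS pu] := meet i iI.
    by case: pickP => [w /andP[wS /eqP]|/(_ u)] //=; rewrite uS pu eqxx.
  have rP : {in I, forall i, r i \in A /\ p (r i) = i}.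
    by move=> i iI; have [rS1 ->] := rS i iI; rewrite (subsetP sSA).
  have yA := subsetP sSA y yS.
  have yr : y != r (p y) by rewrite /r -pxy eqxx.
  have BS b : b \in y |: r @: I -> b \in S.
    by case/setU1P=> [->//|/imsetP[i iI ->]]; case: (rS i iI).
  exfalso; apply: (no_cone (book_sub rP yA)).
  - by rewrite (card_book rP yr) cI.
  - exact: book_injective.
  - by move=> b /BS/SP/(subsetP sR).
  - move=> a b /BS aS /BS bS /injR; rewrite !SP // => /(_ isT isT).
    exact/vinj/(subsetP sSA).
  - move=> a e /BS/SP aR eB; apply: disjR => //.
    exact: (subsetP (pairsS (book_sub rP yA))).
have Ajs : part A p j \subset A by apply/subsetP=> x; rewrite inE => /andP[].
have SAj : S \subset A :\: part A p j.
  apply/subsetP=> x xS; have := Sj x xS.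
  by rewrite inE (subsetP sSA) // inE negb_and => ->; rewrite orbT.
have cj := size_parts jI.
have cAj : #|A :\: part A p j| = #|A| - #|part A p j| by rewrite cardsD (setIidPr Ajs).
have leS := subset_leq_card SAj.
have lejA := subset_leq_card Ajs.
have sA : s < #|A|.
  apply: ltn_Pdiv; first exact: ltnW.
  by apply: leq_trans q2A; rewrite double_gt0 (leq_trans _ q3).
(* As [#|N| <= #|A|] and [#|S| <= #|A| - #|part A p j| <= #|A| - s], the sum in [degv'] forces
   equality throughout. *)
have [cN cjs cSA] : [/\ #|N| = #|A|, #|part A p j| = s & #|S| = #|A| - s].
  move: sA degv' leN leS lejA cj; rewrite cAj -/s.
  move: (#|N|) (#|S|) (#|A|) (#|part A p j|) (s) => a b c d t; clear; split; lia.
have NA : N = A by apply/eqP; rewrite eqEcard sNA cN leqnn.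
have SE : S = A :\: part A p j by apply/eqP; rewrite eqEcard SAj cAj cSA cjs leqnn.
have vE x : x \in A -> [set v; x] \in E by rewrite -{1}NA inE => /andP[].
have vR x : x \in A -> p x != j -> [set v; x] \in R.
  by move=> xA pxj; apply: SP; rewrite SE inE xA inE negb_and pxj orbT.
have Rv e : e \in R -> exists x, [/\ x \in A, p x != j & e = [set v; x]].
  move=> eR; case: (pairsU1 (subsetP sE _ (subsetP sR _ eR))) => [eA|[x xA eE]].
    by case: (disjR _ _ eR eA).
  exists x; split=> //; apply: Sj; by rewrite inE xA -eE.
(* The edges with a private color. *)
pose X := R :|: [set e in pairs A | ~~ inside p e].
have injX : {in X &, injective col}.
  move=> e f /setUP[eR|]; last rewrite inE => /andP[eA ie].
    case/setUP=> [fR|]; first exact: injR.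
    by rewrite inE => /andP[fA _] /(disjR _ _ eR fA).
  case/setUP=> [fR /esym/(disjR _ _ fR eA)//|]; rewrite inE => /andP[fA _] /eqP.
  by rewrite colA // (negbTE ie) orbF => /eqP.
have insX e f : e \in pairs A -> inside p e -> f \in X -> col e != col f.
  move=> eA ie /setUP[fR|]; first by rewrite eq_sym; apply/eqP/disjR.
  rewrite inE => /andP[fA jf]; rewrite colA // (negbTE jf) andbF orbF.
  by apply: contraNneq jf => <-.
(* A pair inside a part, serving as a witness of the common color. *)
have [e0 e0A ie0] := inside_pairs (size_part_ge2 jI).
(* Otherwise a book whose vertex in part [j] is [x] spans a rainbow clique with [v], provided it
   avoids the one edge of [X] that may share the color of [[set v; x]]. *)
have white x : x \in A -> p x = j -> col [set v; x] = col e0.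
  move=> xA pxj; apply/eqP/negPn/negP => ne0.
  (* At most one edge of [X] has this color because [X] is rainbow. It has an end [y] outside part
     [j] and different from [v], and the book will avoid [y]. *)
  have [y [yv yj badP]] : exists y, [/\ y != v, p y != j &
      {in X, forall f : {set V}, col f = col [set v; x] -> y \in f}].
    case: (pickP [pred f in X | col f == col [set v; x]]) => [f|none]; last first.
      have [y yS] : exists y, y \in S by apply/set0Pn; rewrite -card_gt0 SE cAj cjs subn_gt0.
      exists y; split; [exact/vneq/(subsetP sSA) | exact: Sj |].
      by move=> f fX cf; have := none f; rewrite /= fX cf eqxx.
    move=> /= /andP[fX /eqP cf].
    suff [y [yv yj yf]] : exists y, [/\ y != v, p y != j & y \in f].
      by exists y; split=> // g gX cg; rewrite (injX g f) // cg cf.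
    case/setUP: fX => [/Rv[y [yA yj ->]]|].
      by exists y; split; rewrite ?set22 //; apply: vneq.
    rewrite inE => /andP[/pairsP[a [b [aA bA _ ->]]]]; rewrite inside2 => pab.
    have [paj|paj] := eqVneq (p a) j; last by exists a; split; rewrite ?set21 //; apply: vneq.
    by exists b; split; rewrite ?set22 //; [apply: vneq | rewrite -paj eq_sym].
  (* The two vertices of the book in one part come from a part other than those of [x] and [y]; it
     exists because [q >= 3]. *)
  have [i0 /and3P[i0I i0j i0y]] : exists i0, [&& i0 \in I, i0 != j & i0 != p y].
    have : 0 < #|I :\ j :\ p y|.
      have := cardsD1 j I; have := cardsD1 (p y) (I :\ j); rewrite jI cI.
      by move: q3; case: (_ \in _) => /=; clear; card_lia.
    by case/card_gt0P=> i; rewrite !inE => /and3P[? ? ?]; exists i; apply/and3P.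
  have [x1 [x2 [x1P x2P x12]]] := card_gt1P (size_part_ge2 i0I).
  move: x1P x2P; rewrite !inE => /andP[x1A /eqP px1] /andP[x2A /eqP px2].
  (* Each part has at least two vertices, so one of them differs from [y]. *)
  have avoid i : i \in I -> exists2 u, u \in A & (p u == i) && (u != y).
    move=> /size_part_ge2/card_gt1P[a [b []]]; rewrite !inE => /andP[aA pa] /andP[bA pb] ab.
    have [ay|ay] := eqVneq a y; last by exists a; rewrite ?pa.
    by exists b; rewrite // pb -ay eq_sym.
  pose r i := if i == j then x else if i == i0 then x1 else
    odflt x [pick u in A | (p u == i) && (u != y)].
  have rA i : i \in I -> [/\ r i \in A, p (r i) = i & r i != y].
    move=> iI; rewrite /r; have [->|_] := eqVneq i j.
      by split=> //; apply: contraNneq yj => <-; rewrite pxj.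
    have [->|_] := eqVneq i i0.
      by split=> //; apply: contraNneq i0y => <-; rewrite px1.
    have [u uA pu] := avoid i iI.
    by case: pickP => [w /and3P[wA /eqP ? ?]|/(_ u)] //=; rewrite uA pu.
  have rP : {in I, forall i, r i \in A /\ p (r i) = i} by move=> i /rA[].
  have zr : x2 != r (p x2) by rewrite px2 /r (negbTE i0j) eqxx eq_sym.
  have sB := book_sub rP x2A.
  have Bj b : b \in x2 |: r @: I -> p b = j -> b = x.
    case/setU1P=> [->|/imsetP[i iI ->]]; first by rewrite px2 => /eqP; rewrite (negbTE i0j).
    by case: (rP i iI) => _ -> ->; rewrite /r eqxx.
  have By b : b \in x2 |: r @: I -> b != y.
    case/setU1P=> [->|/imsetP[i iI ->]]; last by case: (rA i iI).
    by apply: contraNneq i0y => <-; rewrite px2.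
  have priv b : b \in x2 |: r @: I -> b = x \/ [set v; b] \in R.
    move=> bB; have [/(Bj b bB)|pbj] := eqVneq (p b) j; [by left|right].
    by apply: vR => //; apply: (subsetP sB).
  have notbad b : b \in x2 |: r @: I -> [set v; b] \in R -> col [set v; b] <> col [set v; x].
    move=> bB bR cb; have : y \in [set v; b] by apply: badP => //; rewrite inE bR.
    by rewrite !inE (negbTE yv) eq_sym (negbTE (By b bB)).
  apply: (no_cone sB).
  - by rewrite (card_book rP zr) cI.
  - exact: book_injective.
  - by move=> b /(subsetP sB)/vE.
  - move=> a b aB bB cab; case: (priv a aB) (priv b bB) => [ax|aR] [bx|bR].
    + by rewrite ax bx.
    + by case: (notbad b bB bR); rewrite -cab ax.
    + by case: (notbad a aB aR); rewrite cab bx.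
    + by apply: vinj (injR _ _ aR bR cab); apply: (subsetP sB).
  - move=> b e bB eB; have eA := subsetP (pairsS sB) e eB.
    case: (priv b bB) => [->|bR]; last exact: disjR.
    have [ie|ie] := boolP (inside p e).
      have /eqP : col e == col e0 by rewrite colA // ie ie0 orbT.
      by move=> -> /eqP; rewrite (negbTE ne0).
    move=> ce; have ye : y \in e by apply: badP; rewrite // in_setU [_ \in [set _ in _ | _]]in_set eA ie orbT.
    have : y \in x2 |: r @: I by move: eB; rewrite inE => /andP[/subsetP/(_ y ye)].
    by move/By; rewrite eqxx.
(* The new vertex joins part [j], which has the minimum size [s], so the partition stays
   balanced. *)
pose p' u := if u == v then j else p u.
have p'A x : x \in A -> p' x = p x by move=> /vneq xv; rewrite /p' (negbTE xv).
have p'v : p' v = j by rewrite /p' eqxx.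
have inA e : e \in pairs A -> inside p' e = inside p e.
  by case/pairsP=> a [b [aA bA _ ->]]; rewrite !inside2 !p'A.
have EA : E = pairs (v |: A).
  apply/eqP; rewrite eqEsubset sE; apply/subsetP=> e /pairsU1[/(subsetP pairs_subE)//|].
  by case=> x xA ->; apply: vE.
have dich e : e \in pairs (v |: A) ->
    inside p' e /\ col e = col e0 \/ ~~ inside p' e /\ e \in X.
  case/pairsU1=> [eA|[x xA ->]].
    rewrite inA //; have [ie|ie] := boolP (inside p e); [left|right].
      by split=> //; apply/eqP; rewrite colA // ie ie0 orbT.
    by split=> //; rewrite in_setU in_set eA ie orbT.
  rewrite inside2 p'v p'A // eq_sym; have [pj|pj] := eqVneq (p x) j; [left|right].
    by split=> //; apply: white.
  by split=> //; rewrite inE vR.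
have p'I : p' @: (v |: A) = I.
  rewrite imsetU1 p'v (eq_in_imset p'A); apply/setUidPr; by rewrite sub1set.
exists p'; split=> //; last first.
  move=> e f /dich[[ie ce]|[ie eX]] /dich[[jf cf]|[jf fX]]; rewrite ?(negbTE ie) ?(negbTE jf) ?ie ?jf.
  - by rewrite ce cf eqxx orbT.
  - rewrite ce (negbTE (insX e0 f e0A ie0 fX)) orbF.
    by apply/esym/negbTE; apply: contraNneq jf => <-.
  - rewrite cf eq_sym (negbTE (insX e0 e e0A ie0 eX)) orbF.
    by apply/esym/negbTE; apply: contraNneq ie => ->.
  - by rewrite orbF; apply/eqP/eqP => [/injX|->//]; apply.
split; first by rewrite p'I.
have partE i : part (v |: A) p' i = if i == j then v |: part A p i else part A p i.
  apply/setP=> x; have [->|xv] := eqVneq x v.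
    by rewrite !inE eqxx p'v eq_sym; have [_|_] := eqVneq i j; rewrite !inE ?eqxx // (negbTE vA).
  rewrite /part !inE /p' (negbTE xv) /=; by case: (i == j); rewrite !inE ?(negbTE xv).
have vj i : v \notin part A p i by rewrite inE (negbTE vA).
rewrite p'I => i1 i2 i1I i2I; rewrite !partE.
have := size_parts i1I; have := size_parts i2I.
have [->|_] := eqVneq i1 j; have [->|_] := eqVneq i2 j; rewrite ?cardsU1 ?vj ?cjs; clear; lia.
Qed.

End Extend.
End TuranColored.

(** * Induction on the order, starting from [2q] *)

Lemma turan_colored_of_tight (V T : finType) q
    (E : {set {set V}}) (col : {set V} -> T) (A : {set V}) :
  3 < q -> q.*2 <= #|A| -> E \subset pairs A ->
  #|E| + #|col @: E| + turan_gap q #|A| = ('C(#|A|, 2)).*2.+1 ->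
  (forall K : {set V}, K \subset A -> rclique E col K -> #|K| <= q.+1) ->
  turan_colored q E col A.
Proof.
move=> q3; have q0 : 0 < q by lia.
have [n] := ubnP #|A|; elim: n => // n IH in E col A *; rewrite ltnS => leA q2A sE eqE norb.
(* In the base case the perfect matching [M] is a whole color class, and its pairs are the partite
   sets. *)
have [cA|cA] := eqVneq #|A| q.*2.
  have gap : turan_gap q #|A| + q = #|A| by apply: turan_gap_small; lia.
  have [||EA cc] := small_order_complete sE _ _ norb; [lia | card_lia |].
  rewrite EA in cc norb *.
  have [|M [sM mM cM injM /(_ q3 cA)[sameM colM]]] := small_order_matching _ cc norb; first lia.
  have [p [bal insM]] := matching_parts sM mM cM.
  exists p; split=> // e f eA fA; rewrite !insM //.
  have [eM|eM] := boolP (e \in M); have [fM|fM] := boolP (f \in M) => /=.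
  - by rewrite orbT; apply/eqP/sameM.
  - have [ef|_] := eqVneq e f; first by rewrite -ef eM in fM.
    by apply/eqP => /(colM _ _ eM fA); rewrite (negbTE fM).
  - have [ef|_] := eqVneq e f; first by rewrite ef fM in eM.
    by apply/eqP => /esym/(colM _ _ fM eA); rewrite (negbTE eM).
  - by rewrite orbF; apply/eqP/eqP => [/injM|->//]; rewrite !in_setD eM fM; apply.
case cAE: #|A| => [|m]; first by rewrite cAE in q2A; lia.
have q2m : q.*2 <= m by lia.
rewrite cAE in eqE.
have [v vA degle] := exists_light_vertex q0 q2m cAE sE eqE.
set A' := A :\ v; have cA' : #|A'| = m by have := cardsD1 v A; rewrite vA cAE /A'; lia.
have AE : v |: A' = A by rewrite setD1K.
have vA' : v \notin A' by rewrite !inE eqxx.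
set E' := edges_off E v.
have sE'E : E' \subset E by apply/subsetP=> e; rewrite inE => /andP[].
have sE' : E' \subset pairs A'.
  apply/subsetP=> e; rewrite inE => /andP[/(subsetP sE)]; rewrite !inE => /andP[eA ->] ve.
  by rewrite andbT subsetD1 eA.
have norb' (F : {set {set V}}) (c : {set V} -> T) : F \subset E ->
    (forall e f, col e = col f -> c e = c f) ->
    forall K : {set V}, K \subset A' -> rclique F c K -> #|K| <= q.+1.
  by move=> sF cc K sK /(rcliqueW sF cc); apply: norb; apply: subset_trans sK (subsetDl _ _).
have cE : #|E| = #|E'| + #|edges_at E v|.
  rewrite -(cardsID E' E) (setIidPr sE'E); congr (_ + _); apply: eq_card => e.
  by rewrite !inE; case: (e \in E) => //=; rewrite ?andbT ?negbK ?andbF.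
have ccE : #|col @: E| = #|col @: E'| + #|col @: E :\: col @: E'|.
  by rewrite -(cardsID (col @: E') (col @: E)) (setIidPr (imsetS _ sE'E)).
(* Deleting a light vertex lowers the number of edges plus colors by no more than the bound itself
   drops. *)
have geE' : ('C(#|A'|, 2)).*2.+1 <= #|E'| + #|col @: E'| + turan_gap q #|A'|.
  move: eqE degle; rewrite cA' turan_gapS binS bin1 cE ccE -/E'; clear; card_lia.
have IH' (F : {set {set V}}) (c : {set V} -> T) : F \subset pairs A' ->
    #|F| + #|c @: F| + turan_gap q #|A'| = ('C(#|A'|, 2)).*2.+1 ->
    (forall K : {set V}, K \subset A' -> rclique F c K -> #|K| <= q.+1) -> turan_colored q F c A'.
  by apply: IH; rewrite cA' //; move: leA; rewrite cAE.
(* By the induction hypothesis every graph on [A'] meeting the bound exactly is complete, so the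
   bound cannot be exceeded there. *)
have eqE' : #|E'| + #|col @: E'| + turan_gap q #|A'| = ('C(#|A'|, 2)).*2.+1.
  apply: (@tight_of_complete _ T) => //; [ | | exact: norb'].
    by rewrite cA'; move: q2m q3; clear; lia.
  by move=> F c sF eqF /(IH' F c sF eqF)[p []].
have [p [offE bal colA]] := IH' E' col sE' eqE' (norb' E' col sE'E (fun _ _ => id)).
rewrite -AE; apply: (@extend_turan_colored _ _ _ _ _ _ _ _ _ vA' _ _ _ p) => //.
- exact: ltnW.
- by rewrite cA'.
- by rewrite AE.
- by rewrite AE.
(* Both orders meet their bounds exactly, so the inequality for [v] is an equality. *)
- move: eqE eqE' degle; rewrite cA' turan_gapS binS bin1 cE ccE -/E'; clear; card_lia.
Qed.

(** * Transfer to graphs on ordinals *)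

(** List each missing edge by its larger end [y]: exactly [y %/ q] smaller numbers are congruent to
    [y]. *)
Lemma turan_num_gap n q : 0 < q -> turan_num n q + turan_gap q n = 'C(n, 2).
Proof.
move=> q0.
have sT : turan_edges n q \subset pairs [set: 'I_n].
  by apply/subsetP=> e /turan_card2 e2; rewrite inE subsetT e2.
rewrite -[n in 'C(n, 2)]card_ord -cardsT -card_pairs -(cardsID (turan_edges n q)) (setIidPr sT).
congr (_ + _).
pose D := [set u : 'I_n * 'I_n | (u.1 < u.2) && (u.1 == u.2 %[mod q])].
have -> : pairs setT :\: turan_edges n q = [set [set u.1; u.2] | u in D].
  apply/setP=> e; apply/setDP/imsetP => [[/pairsP[x [y [_ _ xy ->]]]]|[[x y]]].
    have [xyq _|xyq] := eqVneq (x %% q) (y %% q); last first.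
      by case/negP; apply/imset2P; exists x y; rewrite ?inE.
    have [lt|lt|eq] := ltngtP x y; last by case/eqP: xy; apply: val_inj.
      by exists (x, y); rewrite // inE lt; apply/eqP.
    by exists (y, x); rewrite ?inE ?lt 1?setUC //=; apply/eqP.
  rewrite inE => /= /andP[lt xyq] ->; have xy : x != y by apply: contraTneq lt => ->; rewrite ltnn.
  split; first by rewrite mem_pairs2 ?inE.
  apply/negP=> /imset2P[a b _]; rewrite inE => /andP[_ ab] E.
  have aP : a \in [set x; y] by rewrite E set21.
  have bP : b \in [set x; y] by rewrite E set22.
  case/negP: ab; move: aP bP; rewrite !inE => /orP[]/eqP-> /orP[]/eqP-> //.
  by rewrite eq_sym.
rewrite card_in_imset; last first.
  move=> [x y] [x' y']; rewrite !inE /= => /andP[lt _] /andP[lt' _] E.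
  have e1 : x \in [set x'; y'] by rewrite -E set21.
  have e2 : y \in [set x'; y'] by rewrite -E set22.
  move: e1 e2; rewrite !inE => /orP[]/eqP e1 /orP[]/eqP e2; subst x y => //.
  - by rewrite ltnn in lt.
  - by have := ltn_trans lt lt'; rewrite ltnn.
  - by rewrite ltnn in lt.
symmetry; transitivity (\sum_(x < n) \sum_(y < n) ((x < y) && (x == y %[mod q]) : nat)).
  rewrite pair_bigA -sum1_card big_mkcond /=.
  by apply: eq_bigr => u _; rewrite inE; case: (_ && _).
rewrite exchange_big /=; apply: eq_bigr => y _.
have := card_turan_part y (Ordinal (ltn_pmod y q0)); rewrite /= ltnn addn0 => <-.
rewrite cardsE -sum1_card.
rewrite (big_ord_widen_cond n (fun x => x %% q == y %% q) (fun=> 1)) ?(ltnW (ltn_ord y)) //.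
rewrite [RHS]big_mkcond /=.
by apply: eq_bigr => x _; rewrite andbC; case: (_ && _).
Qed.

(** * Numbering the vertices of a balanced partition by residues *)

Section BalancedBijection.
Variables (V I : finType) (q : nat) (p : V -> I).
Hypotheses (q0 : 0 < q) (bal : balanced q [set: V] p).

Let b := #|V| %/ q.
Let r := #|V| %% q.
Let J := p @: [set: V].
Let big i := b < #|part setT p i|.
(** The [r] parts with [b + 1] vertices come first. Modulo [q], [code] gives the position of the
    part in [s], and its quotient the place within the part; a quotient [b] occurs only at positions
    below [r], so codes stay below [b * q + r]. *)
Let s := [seq i <- enum J | big i] ++ [seq i <- enum J | ~~ big i].
Let code x := index x (enum (part setT p (p x))) * q + index (p x) s.

Lemma card_big_parts : size [seq i <- enum J | big i] = r.
Proof.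
have [cJ _] := bal.
have sz i : i \in J -> #|part setT p i| = b + big i.
  by move/(card_part_balanced q0 bal); rewrite cardsT -/b /big; case: ltnP => /=; lia.
have sum : #|V| = b * q + size [seq i <- enum J | big i].
  rewrite -cardsT -(sum_card_part setT p) (eq_bigr (fun i => b + big i)) //.
  rewrite big_split /= sum_nat_const -/J cJ mulnC; congr (_ + _).
  by rewrite size_filter -sum1_count big_enum_cond /= -big_mkcondr.
have := divn_eq #|V| q; rewrite {1}sum -/b -/r => /addnI //.
Qed.

Lemma mem_part_seq x : p x \in s.
Proof.
by rewrite mem_cat (mem_filter big) (mem_filter (fun i => ~~ big i)) mem_enum imset_f ?in_setT // !andbT orbN.
Qed.

Lemma size_part_seq : size s = q.
Proof.
have [cJ _] := bal.
by rewrite size_cat !size_filter count_predC -cardE -/J cJ.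
Qed.

Lemma index_part_lt x : index (p x) s < q.
Proof. by rewrite -size_part_seq index_mem mem_part_seq. Qed.

Lemma code_lt x : code x < #|V|.
Proof.
have qx := index_part_lt x.
have xP : x \in enum (part setT p (p x)) by rewrite mem_enum !inE eqxx.
have ix : index x (enum (part setT p (p x))) < #|part setT p (p x)|.
  by rewrite [X in _ < X]cardE index_mem.
have pJ : p x \in J by rewrite imset_f.
have := card_part_balanced q0 bal pJ; rewrite cardsT -/b => /andP[_ ub].
have VE : #|V| = b * q + r := divn_eq _ _.
rewrite /code; move: (index x _) ix => i ix.
have [bx|bx] := boolP (big (p x)).
  have : index (p x) s < r.
    by rewrite /s index_cat mem_filter bx mem_enum pJ -card_big_parts index_mem mem_filter bx mem_enum.
  have : i * q <= b * q by rewrite leq_mul2r -[i <= b]ltnS (leq_trans ix) ?orbT.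
  lia.
have : i.+1 * q <= b * q.
  by rewrite leq_mul2r (leq_trans ix) ?orbT // leqNgt.
by rewrite mulSn; lia.
Qed.

Lemma balanced_bijection n : #|V| = n ->
  exists2 f : V -> 'I_n, bijective f & forall x y, (f x == f y %[mod q]) = (p x == p y).
Proof.
move=> cV; have lt x : code x < n by rewrite -cV code_lt.
have cmod x : code x %% q = index (p x) s by rewrite modnMDl modn_small // index_part_lt.
have cdiv x : code x %/ q = index x (enum (part setT p (p x))).
  by rewrite /code divnMDl // divn_small ?addn0 // index_part_lt.
have modE x y : (code x == code y %[mod q]) = (p x == p y).
  rewrite !cmod; apply/eqP/eqP => [|-> //].
  by move/(congr1 (nth (p x) s)); rewrite !nth_index ?mem_part_seq.
exists (fun x => Ordinal (lt x)); last exact: modE.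
apply: inj_card_bij; last by rewrite card_ord cV.
move=> x y [cxy]; have /eqP pxy : p x == p y by rewrite -modE cxy.
have := cdiv x; rewrite cxy cdiv -pxy => /(congr1 (nth x (enum (part setT p (p x))))).
by rewrite !nth_index // mem_enum !inE ?pxy eqxx.
Qed.

End BalancedBijection.

(** Each color is replaced by a chosen edge bearing it, so that colors live in a finite type and can
    be counted as an image. *)
Lemma exists_finite_coloring (C : eqType) (S : finType) (E : {set S}) (c : S -> C) :
  exists2 col : S -> S, {in E &, forall e f, (col e == col f) = (c e == c f)}
    & #|col @: E| = size (undup [seq c e | e in E]).
Proof.
pose col e := odflt e [pick f in E | c f == c e].
have colP e : e \in E -> c (col e) = c e.
  by rewrite /col => eE; case: pickP => [f /andP[_ /eqP]|/(_ e)] //=; rewrite eE eqxx.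
have colE : {in E &, forall e f, (col e == col f) = (c e == c f)}.
  move=> e f eE fE; apply/eqP/eqP => [ef|ef]; first by rewrite -(colP e) // ef colP.
  rewrite /col (eq_pick (_ : _ =1 [pred g in E | c g == c f])) => [|g /=]; last by rewrite ef.
  by case: pickP => // /(_ f); rewrite /= fE eqxx.
exists col => //.
have [R sR [injR colR]] := exists_transversal col E.
rewrite -colR (card_in_imset injR) cardE -(size_map c).
apply/perm_size/uniq_perm; rewrite ?undup_uniq //.
  rewrite map_inj_in_uniq ?enum_uniq // => e f; rewrite !mem_enum => eR fR /eqP.
  by rewrite -colE ?(subsetP sR) // => /eqP; apply: injR.
move=> x; rewrite mem_undup; apply/mapP/imageP => [[e]|[e eE ->]].
  by rewrite mem_enum => /(subsetP sR); exists e.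
have : col e \in col @: R by rewrite colR imset_f.
case/imsetP=> f fR /eqP ef; exists f; rewrite ?mem_enum //.
by apply/eqP; rewrite -colE // (subsetP sR).
Qed.

Lemma imset2_pair (S S' : finType) (f : S -> S') x y : f @: [set x; y] = [set f x; f y].
Proof. by rewrite imsetU1 imset_set1. Qed.

Lemma contains_rainbow_clique (C : eqType) (V : finType) (G : ecgraph C V) (K : {set V}) k :
  k <= #|K| -> pairs K \subset edges G -> {in pairs K &, injective (color G)} ->
  contains_rainbow (complete_graph 'I_k) G.
Proof.
move=> kK sK inj; pose f (i : 'I_k) := enum_val (widen_ord kK i).
have injf : injective f by move=> i j /enum_val_inj [] /val_inj.
have fK i : f i \in K := enum_valP _.
have sub : [set f @: e | e : {set 'I_k} in edges (complete_graph 'I_k)] \subset pairs K.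
  apply/subsetP=> e' /imsetP[e + ->]; rewrite !inE => /eqP e2; rewrite card_imset // e2 andbT.
  by apply/subsetP=> _ /imsetP[i _ ->].
exists f; split=> //; first exact: subset_trans sK.
by move=> e e' /(subsetP sub) eK /(subsetP sub); apply: inj.
Qed.

Lemma mem_turan_edges n q (x y : 'I_n) :
  ([set x; y] \in turan_edges n q) = (x != y %[mod q]).
Proof.
apply/imset2P/idP => [[a b _]|xy]; last by exists x y; rewrite ?inE.
rewrite inE => /andP[_ ab] E; apply: contra ab => xy.
have : a \in [set x; y] by rewrite E set21.
have : b \in [set x; y] by rewrite E set22.
by rewrite !inE => /orP[]/eqP-> /orP[]/eqP-> //; rewrite eq_sym.
Qed.

Theorem theorem6 (n k : nat) (C : eqType) (V : finType) (G : ecgraph C V) :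
  6 <= k -> k <= n -> #|V| = n ->
  num_edges G + num_colors G = 'C(n, 2) + turan_num n (k - 2) + 1 ->
  ~ contains_rainbow (complete_graph 'I_k) G ->
  H_family k G.
Proof.
move=> k6 kn cV eqG norbG.
set q := k - 2 in eqG *; have kE : k = q.+2 by rewrite /q; lia.
have q3 : 3 < q by lia.
have q0 : 0 < q by apply: ltn_trans q3.
have gap := turan_num_gap n q0.
have [col colE ccol] := exists_finite_coloring (edges G) (color G).
have ccol' : #|col @: edges G| = num_colors G by rewrite ccol.
have cT : #|[set: V]| = n by rewrite cardsT.
have sE : edges G \subset pairs [set: V].
  by apply/subsetP=> e /(@edges_card2 _ G) e2; rewrite inE subsetT e2.
have PE : pairs [set: V] = edges (complete_graph V).
  by apply/setP=> e; rewrite !inE subsetT.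
have norb (K : {set V}) : K \subset [set: V] -> rclique (edges G) col K -> #|K| <= q.+1.
  move=> _ [sK inj]; rewrite leqNgt; apply/negP=> cK; apply: norbG.
  apply: (@contains_rainbow_clique _ _ _ K) => //; first by rewrite kE.
  move=> e f eK fK /eqP; rewrite -colE ?(subsetP sK) // => /eqP; exact: inj.
have tight : #|edges G| + #|col @: edges G| + turan_gap q #|[set: V]| = ('C(#|[set: V]|, 2)).*2.+1.
  by move: eqG gap; rewrite ccol' cT /num_edges; clear; lia.
(* Orders below [2q] give case (II); from [2q] on the coloring is determined and case (I) holds. *)
have [n2q|n2q] := ltnP n q.*2.
  right; rewrite cV -/q.
  have gapn : turan_gap q n + q = n by apply: turan_gap_small => //; apply/andP; split; lia.
  have [||EA cc] := small_order_complete sE _ _ norb.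
  - by rewrite cT -kE.
  - by move: tight gapn; rewrite cT; clear; card_lia.
  rewrite EA in norb.
  have [||M [sM mM cM injM _]] := small_order_matching _ _ norb.
  - by rewrite cT -kE kn ltnW.
  - by rewrite -EA.
  have [p [bal insM]] := matching_parts sM mM cM.
  have [f [g fK gK] fE] := balanced_bijection q0 bal cV.
  (* The inverse of the numbering embeds T_{n,q} into the rainbow complement of [M]. *)
  have turanE e : e \in turan_edges n q -> g @: e \in pairs setT :\: M.
    case/imset2P=> a b _; rewrite inE => /andP[_ ab] ->; rewrite imset2_pair.
    have pab : p (g a) != p (g b) by rewrite -fE !gK.
    have P : [set g a; g b] \in pairs setT by rewrite mem_pairs2 ?inE //; apply: contraNneq pab => ->.
    by rewrite inE P -insM // inside2 pab.
  split=> //.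
  - have -> : n = 1 * q + (n - q) by lia.
    by rewrite divnMDl // divn_small // -(ltn_add2r q) subnK ?addnn //; lia.
  - by rewrite /is_complete EA PE.
  - by move: cc gapn gap; rewrite ccol' cT; clear; lia.
  exists g; split; first exact: can_inj gK.
    by apply/subsetP=> _ /imsetP[e /turanE/setDP[eP _] ->]; rewrite EA.
  move=> _ _ /imsetP[e /turanE eP ->] /imsetP[e' /turanE e'P ->] /eqP.
  have [eA _] := setDP eP; have [eA' _] := setDP e'P.
  by rewrite -colE ?EA // => /eqP; apply: injM.
left; rewrite cV -/q.
have [|p [EA bal colp]] := turan_colored_of_tight q3 _ sE tight norb; first by rewrite cT.
have [f bijf fE] := balanced_bijection q0 bal cV.
have injf := bij_inj bijf.
have turanE e : e \in edges G -> (f @: e \in turan_edges n q) = ~~ inside p e.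
  by rewrite EA => /pairsP[x [y [_ _ _ ->]]]; rewrite imset2_pair inside2 -fE mem_turan_edges.
have cG e e' : e \in edges G -> e' \in edges G ->
    (color G e == color G e') = (e == e') || inside p e && inside p e'.
  by move=> eE e'E; rewrite -colE // colp // -EA.
(* A color borne by an edge between parts is sent to the image of that edge; for the common color
   nothing is picked and [None] results. *)
pose g c := omap (fun e : {set V} => f @: e)
  [pick e in edges G | (color G e == c) && ~~ inside p e].
have gE e : e \in edges G -> g (color G e) = if inside p e then None else Some (f @: e).
  move=> eE; rewrite /g; case: pickP => [e' /and3P[e'E cee' ie']|none] /=.
    move: cee'; rewrite cG // (negbTE ie') /= orbF => /eqP ee'.
    by rewrite -ee' (negbTE ie').
  by have := none e; rewrite /= eE eqxx /=; case: (inside p e).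
exists f, g; split=> //.
- move=> e; rewrite EA PE !inE card_imset //.
- move=> c c'; rewrite !mem_undup => /imageP[e eE ->] /imageP[e' e'E ->].
  rewrite !gE //; have [ie|ie] := boolP (inside p e); have [ie'|ie'] := boolP (inside p e') => //.
    by move=> _; apply/eqP; rewrite cG // ie ie' orbT.
  by case=> /(imset_inj injf) ->.
- move=> e eE; rewrite gE //= turanE //; by case: (inside p e).
Qed.
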